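(* Let $u,v,w$ be weights such that $u^{-1}w^2, v\in L^1_{\mathrm{loc}}(\mathbb{R})$. Suppose that the weighted dyadic square function $S_w^d$ is bounded from $L^2(u)$ into $L^2(v)$. Then (i) there is a constant $C>0$ such that for all $J\in\mathcal{D}$, $$\left(\frac{w(J^* )}{w(\widetilde J)}\right)^2\langle u^{-1}w\rangle_J^w\,\langle vw^{-1}\rangle_J^w\le C;$$ (ii) there is a constant $C>0$ such that for all $J\in\mathcal{D}$, $$\frac{1}{w(J)}\sum_{I\in\mathcal{D}(J)}\big|\Delta_I^w(u^{-1}w)\big|^2\left[\frac{w(I^-)^2\,v(I^+)+w(I^+)^2\,v(I^-)}{w(I)^2}\right]\le C\,\langle u^{-1}w\rangle_J^w .$$
   Context: A weight is an almost everywhere positive, locally integrable function on $\mathbb{R}$. $\mathcal{D}$ is the family of dyadic intervals $[k2^{-j},(k+1)2^{-j})$, $k,j\in\mathbb{Z}$; for $J\in\mathcal{D}$, $\mathcal{D}(J)=\{I\in\mathcal{D}: I\subset J\}$. For $I\in\mathcal{D}$, $I^+$ and $I^-$ are its right and left halves (children), $\widetilde I\in\mathcal D$ is its dyadic parent, and $I^*$ is its dyadic sibling, so $I\cup I^*=\widetilde I$. For a weight $\omega$, $\omega(I)=\int_I\omega(x)\,dx$. The weighted average of $f$ with respect to $w$ is $\langle f\rangle_I^w=\frac{1}{w(I)}\int_I f(x)w(x)\,dx$, and $\Delta_I^w(g)=\langle g\rangle_{I^+}^w-\langle g\rangle_{I^-}^w$. $L^2(u)$ denotes $L^2(\mathbb{R},u\,dx)$.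 The weighted dyadic square function (also written $S_w$) is $$S_w^df(x)=\Big(\sum_{I\in\mathcal{D}}|\langle f\rangle_I^w-\langle f\rangle_{\widetilde I}^w|^2\,\mathbf{1}_I(x)\Big)^{1/2}.$$ It is bounded from $L^2(u)$ into $L^2(v)$ if there is a constant $C>0$ with $\|S_w^df\|_{L^2(v)}\le C\|f\|_{L^2(u)}$ for all $f\in L^2(u)$. *)

(* Defs.v *)
From mathcomp Require Import all_boot all_order all_algebra.
From mathcomp Require Import all_classical all_reals all_analysis.

Set Implicit Arguments.
Unset Strict Implicit.
Unset Printing Implicit Defensive.

Import Order.TTheory GRing.Theory Num.Theory.
Import numFieldNormedType.Exports.

Local Open Scope classical_set_scope.
Local Open Scope ring_scope.

(** (j, k) stands for [k 2^-j, (k+1) 2^-j[; this indexing of the dyadic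
    intervals is one-to-one (ditv_inj), so that a sum over indices is a sum
    over intervals. *)
Definition dyadic : Type := (int * int)%type.

Definition ditv (R : realType) (I : dyadic) : set R :=
  `[I.2%:~R * 2 ^ (- I.1), (I.2 + 1)%:~R * 2 ^ (- I.1)[%classic.
Arguments ditv : clear implicits.

Definition lchild (I : dyadic) : dyadic := (I.1 + 1, 2 * I.2).
Definition rchild (I : dyadic) : dyadic := (I.1 + 1, 2 * I.2 + 1).
Definition parent (I : dyadic) : dyadic := (I.1 - 1, (I.2 %/ 2)%Z).
Definition sibling (I : dyadic) : dyadic :=
  (I.1, if (2 %| I.2)%Z then I.2 + 1 else I.2 - 1).

Section dyadic_facts.
Variable R : realType.

Lemma ditv_inj : injective (ditv R).
Proof.
have p0 (n : int) : (0 : R) < 2 ^ n by rewrite exprz_gt0.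
have lt_itv (a : dyadic) :
    a.2%:~R * 2 ^ (- a.1) < (a.2 + 1)%:~R * 2 ^ (- a.1) :> R.
  by rewrite ltr_pM2r// ltr_int ltrDl.
move=> [j k] [j' k'] H.
have lo (a b : dyadic) : ditv R a `<=` ditv R b ->
    b.2%:~R * 2 ^ (- b.1) <= a.2%:~R * 2 ^ (- a.1) :> R.
  move=> /(_ (a.2%:~R * 2 ^ (- a.1))); rewrite /ditv /= !in_itv /= lexx lt_itv.
  by move=> /(_ isT)/andP[].
have hi (a b : dyadic) : ditv R a `<=` ditv R b ->
    (a.2 + 1)%:~R * 2 ^ (- a.1) <= (b.2 + 1)%:~R * 2 ^ (- b.1) :> R.
  move=> ab; rewrite leNgt; apply/negP => ltba.
  pose x : R := Order.max ((b.2 + 1)%:~R * 2 ^ (- b.1)) (a.2%:~R * 2 ^ (- a.1)).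
  have : ditv R a x.
    by rewrite /ditv /= in_itv /= le_max lexx orbT /= gt_max ltba lt_itv.
  by move=> /ab; rewrite /ditv /= in_itv /= gt_max ltxx andbF.
have eL : k%:~R * 2 ^ (- j) = k'%:~R * 2 ^ (- j') :> R.
  by apply/eqP; rewrite eq_le (lo (j', k') (j, k)) ?(lo (j, k) (j', k'))// H.
have eU : (k + 1)%:~R * 2 ^ (- j) = (k' + 1)%:~R * 2 ^ (- j') :> R.
  by apply/eqP; rewrite eq_le (hi (j', k') (j, k)) ?(hi (j, k) (j', k'))// H.
have e2 : 2 ^ (- j) = 2 ^ (- j') :> R.
  by move: eU; rewrite !intrD !mulrDl eL !mul1r => /addrI.
have ejj : j = j'.
  by apply: oppr_inj; apply: (ieexprIz (x := 2 : R)) => //; rewrite (eqr_nat R 2 1).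
move: eL; rewrite ejj => /mulIf; rewrite gt_eqF// => /(_ isT)/eqP.
by rewrite eqr_int => /eqP ->.
Qed.

Lemma lchildK : cancel lchild parent.
Proof. by move=> [j k]; rewrite /parent /= addrK mulKz. Qed.

Lemma rchildK : cancel rchild parent.
Proof.
by move=> [j k]; rewrite /parent /= addrK mulrC divzMDl// (@divz_small 1 2)// addr0.
Qed.

Lemma ditvU_children I : ditv R (lchild I) `|` ditv R (rchild I) = ditv R I.
Proof.
case: I => j k; rewrite /ditv /=.
have e (m : int) : (2 * m)%:~R * 2 ^ (- (j + 1)) = m%:~R * 2 ^ (- j) :> R.
  rewrite opprD expfzDr ?pnatr_eq0// exprN1 intrM (mulrC 2%:~R) -mulrA.
  by rewrite (mulrCA 2%:~R) divff ?mulr1// pnatr_eq0.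
have -> : 2 * k + 1 + 1 = 2 * (k + 1) by rewrite mulrDr mulr1 -addrA.
rewrite !e -itv_bndbnd_setU// bnd_simp -e ler_pM2r ?exprz_gt0// ler_int.
  by rewrite lerDl.
by rewrite mulrDr lerD2l.
Qed.

Lemma ditvU_sibling I : ditv R I `|` ditv R (sibling I) = ditv R (parent I).
Proof.
rewrite -(ditvU_children (parent I)); case: I => j k.
rewrite /lchild /rchild /sibling /= subrK.
have := divz_eq k 2; have := modz_ge0 k (isT : 2 != 0 :> int).
have := ltz_pmod k (isT : 0 < 2 :> int).
rewrite (sameP dvdz_mod0P eqP) (mulrC 2).
set q := (k %/ 2)%Z; case: (k %% 2)%Z => [[|[|n]]|n] //= _ _.
  by rewrite addr0 => ->.
by move=> -> ; rewrite addrK setUC.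
Qed.

End dyadic_facts.

Section weighted.
Variable R : realType.
Implicit Types (u v w f : R -> R) (I J : dyadic).

Local Notation mu := (@lebesgue_measure R).

Definition weight w : Prop :=
  locally_integrable [set: R] w /\ {ae mu, forall x, 0 < w x}.

Definition mass w I : R := \int[mu]_(x in ditv R I) w x.

Definition wavg w I f : R :=
  (mass w I)^-1 * \int[mu]_(x in ditv R I) (f x * w x).

Definition wdelta w I f : R := wavg w (rchild I) f - wavg w (lchild I) f.

(** Values in [0, +oo]: the series may diverge. *)
Definition square_fun w f (x : R) : \bar R :=
  ((\esum_(I in [set: dyadic])
      (`|wavg w I f - wavg w (parent I) f| ^+ 2 * \1_(ditv R I) x)%:E)
   `^ 2^-1)%E.

Definition wL2norm u (g : R -> \bar R) : \bar R :=
  ((\int[mu]_x (`|g x| ^+ 2 * (u x)%:E)) `^ 2^-1)%E.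

Definition wL2 u f : Prop :=
  measurable_fun [set: R] f /\ (wL2norm u (EFin \o f) < +oo)%E.

Definition bounded_L2 (S : (R -> R) -> R -> \bar R) u v : Prop :=
  exists C : R, 0 < C /\
    forall f, wL2 u f -> (wL2norm v (S f) <= C%:E * wL2norm u (EFin \o f))%E.

End weighted.

(* Main.v *)
(** Both bounds come from testing the square function on [f = u^-1 w 1_J], for
    which [||f||_{L^2(u)}^2] is the integral of [u^-1 w^2] over [J].
    Keeping only finitely many terms of the series, boundedness gives
      [sum_K |<f>_K - <f>_{parent K}|^2 v(K) <= C^2 ||f||_{L^2(u)}^2].
    With the single term [K = J], the factor [w(sibling J) / w(parent J)] appears
    because [f] vanishes on the sibling of [J]: (i) follows.  With [K] running
    over the children of dyadic intervals [I] contained in [J],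
      [<f>_{I^+} - <f>_I = (w(I^-) / w(I)) Delta_I f] and
      [<f>_{I^-} - <f>_I = - (w(I^+) / w(I)) Delta_I f],
    so the two children of [I] give exactly the [I]-th term of (ii). *)

Require Import Defs.
From mathcomp Require Import all_boot all_order all_algebra.
From mathcomp Require Import all_classical all_reals all_analysis.
From mathcomp Require Import measurable_realfun.
From mathcomp Require Import ring zify.

Set Implicit Arguments.
Unset Strict Implicit.
Unset Printing Implicit Defensive.

Import Order.TTheory GRing.Theory Num.Theory.
Import numFieldNormedType.Exports.
Local Open Scope classical_set_scope.
Local Open Scope ring_scope.

(** * Measurability of inversion and of nonnegative unordered sums *)

Lemma measurable_inv (R : realType) : measurable_fun [set: R] (@GRing.inv R).
Proof.
have <- : [set~ 0 : R] `|` [set 0] = setT by exact: setvU.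
apply/measurable_funU; rewrite //; first exact: measurableC.
split; last exact: measurable_fun_set1.
apply: open_continuous_measurable_fun.
  by rewrite openC; exact: closed_eq.
by move=> x; rewrite inE => /eqP/inv_continuous.
Qed.

(** Pickling the countable index type turns the unordered sum into a series over the naturals, where
    countable sums of nonnegative measurable functions apply. *)
Lemma measurable_esum d (T : measurableType d) (R : realType) (I : countType)
    (S : set I) (D : set T) (h : I -> T -> \bar R) :
    (forall i x, (0 <= h i x)%E) -> (forall i, measurable_fun D (h i)) ->
  measurable_fun D (fun x => (\esum_(i in S) h i x)%E).
Proof.
move=> h0 mh.
pose g n x := if unpickle n is Some i then h i x else 0%E.
have g0 n x : (0 <= g n x)%E by rewrite /g; case: unpickle.
rewrite [X in measurable_fun _ X](_ : _ =
    fun x => (\sum_(n <oo | n \in mem (pickle @` S)) g n x)%E).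
  apply: ge0_emeasurable_sum => // n _; rewrite /g.
  by case: unpickle => // i; exact: mh.
apply/funext => x; rewrite nneseries_esum//.
rewrite -(_ : pickle @` S = [set n | n \in mem (pickle @` S)]); last first.
  by apply/seteqP; split=> n /=; rewrite inE.
rewrite esum_image; last by move=> i j _ _ /(pcan_inj (@pickleK I)).
by apply: eq_esum => i _; rewrite /g pickleK.
Qed.

(** * Geometry of dyadic intervals and integrability on them *)

Section dyadic_intervals.
Variable R : realType.
Local Notation mu := (@lebesgue_measure R).

Lemma measurable_ditv I : measurable (ditv R I).
Proof. exact: measurable_itv. Qed.

Lemma ditv_lchild_subset I : ditv R (lchild I) `<=` ditv R I.
Proof. by rewrite -(ditvU_children R I); exact: subsetUl. Qed.

Lemma ditv_rchild_subset I : ditv R (rchild I) `<=` ditv R I.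
Proof. by rewrite -(ditvU_children R I); exact: subsetUr. Qed.

Lemma ditv_parent_subset I : ditv R I `<=` ditv R (parent I).
Proof. by rewrite -(ditvU_sibling R I); exact: subsetUl. Qed.

Lemma ditv_endpoints_lt (I : dyadic) :
  I.2%:~R * 2 ^ (- I.1) < (I.2 + 1)%:~R * 2 ^ (- I.1) :> R.
Proof. by rewrite ltr_pM2r ?exprz_gt0// ltr_int ltrDl. Qed.

Lemma disj_ditv_children I : [disjoint ditv R (lchild I) & ditv R (rchild I)].
Proof.
apply/disj_setPS => x; rewrite /ditv /= !in_itv /= => -[/andP[_ h1] /andP[h2 _]].
by have := lt_le_trans h1 h2; rewrite ltxx.
Qed.

(** The parity of the index decides the case; questions about siblings thus reduce to the two
    children of one interval. *)
Lemma sibling_parentP (I : dyadic) :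
  (I = lchild (parent I) /\ sibling I = rchild (parent I)) \/
  (I = rchild (parent I) /\ sibling I = lchild (parent I)).
Proof.
case: I => j k; rewrite /lchild /rchild /sibling /parent /= subrK.
have := divz_eq k 2; have := modz_ge0 k (isT : 2 != 0 :> int).
have := ltz_pmod k (isT : 0 < 2 :> int).
rewrite (sameP dvdz_mod0P eqP) (mulrC 2).
set q := (k %/ 2)%Z; case: (k %% 2)%Z => [[|[|n]]|n] //= _ _.
  by rewrite addr0 => ->; left.
by move=> -> ; rewrite addrK; right.
Qed.

Lemma disj_ditv_sibling I : [disjoint ditv R I & ditv R (sibling I)].
Proof.
case: (sibling_parentP I) => -[eI ->]; rewrite {1}eI.
  exact: disj_ditv_children.
by rewrite disj_set_sym; exact: disj_ditv_children.
Qed.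

Lemma lebesgue_measure_ditv_gt0 I : (0 < mu (ditv R I))%E.
Proof.
rewrite /ditv lebesgue_measure_itv /= lte_fin ditv_endpoints_lt.
by rewrite -EFinB lte_fin subr_gt0 ditv_endpoints_lt.
Qed.

(** A half-open interval is not compact, so integrability is taken on the closed interval with the
    same endpoints and then restricted. *)
Lemma locally_integrable_ditv (f : R -> R) I :
  locally_integrable [set: R] f -> mu.-integrable (ditv R I) (EFin \o f).
Proof.
move=> [mf _ fK]; rewrite /ditv.
set a := (X in Interval (BLeft X) _); set b := (X in Interval _ (BLeft X)).
have : mu.-integrable `[a, b] (EFin \o f).
  apply/integrableP; split; last exact/fK/segment_compact.
  by apply/measurable_EFinP; exact: measurable_funS mf.
apply: integrableS => //; last by apply: subset_itvl; rewrite bnd_simp.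
Qed.

End dyadic_intervals.

(** * Masses of weights, and partial sums of the square function *)

Section mass.
Variable R : realType.
Local Notation mu := (@lebesgue_measure R).
Implicit Types (u v w f g : R -> R) (I J : dyadic).

Lemma EFin_mass f I : locally_integrable [set: R] f ->
  (mass f I)%:E = (\int[mu]_(x in ditv R I) (f x)%:E)%E.
Proof.
move=> fi; rewrite fineK//; apply: integrable_fin_num; first exact: measurable_ditv.
exact: locally_integrable_ditv.
Qed.

Lemma mass_children f I : locally_integrable [set: R] f ->
  mass f I = mass f (lchild I) + mass f (rchild I).
Proof.
move=> fi; rewrite /mass -Rintegral_setU ?ditvU_children//.
- exact: measurable_ditv.
- exact: measurable_ditv.
- exact: locally_integrable_ditv.
- exact: disj_ditv_children.
Qed.

Lemma mass_sibling f I : locally_integrable [set: R] f ->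
  mass f (parent I) = mass f I + mass f (sibling I).
Proof.
move=> fi; rewrite /mass -Rintegral_setU ?ditvU_sibling//.
- exact: measurable_ditv.
- exact: measurable_ditv.
- exact: locally_integrable_ditv.
- exact: disj_ditv_sibling.
Qed.

Lemma weight_measurable w : weight w -> measurable_fun [set: R] w.
Proof. by case=> -[]. Qed.

Lemma weight_ae_norm v : weight v ->
  {ae mu, forall x, (v x)%:E = (`|v x|)%:E}.
Proof.
move=> [_]; apply: (@filterS _ _ (ae_filter_ringOfSetsType mu)) => x /ltW v0.
by rewrite ger0_norm.
Qed.

Lemma weight_normE v I : weight v ->
  (mass v I)%:E = (\int[mu]_(x in ditv R I) (`|v x|)%:E)%E.
Proof.
move=> wv; rewrite EFin_mass; last by case: wv.
have mv := weight_measurable wv.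
apply: ae_eq_integral.
- exact: measurable_ditv.
- by apply/measurable_EFinP; exact: measurable_funS mv.
- apply/measurable_EFinP/measurableT_comp => //.
  exact: measurable_funS mv.
- move: (weight_ae_norm wv).
  by apply: (@filterS _ _ (ae_filter_ringOfSetsType mu)) => x.
Qed.

(** Zero mass would force [w] to vanish almost everywhere on an interval of positive length. *)
Lemma mass_gt0 w I : weight w -> 0 < mass w I.
Proof.
move=> ww; rewrite -lte_fin weight_normE// lt_neqAle integral_ge0 ?andbT//.
have mv := weight_measurable ww.
apply/eqP => /esym int0; have [_ wpos] := ww.
have w0 : ae_eq mu (ditv R I) (EFin \o w) (cst 0%E).
  apply/ae_eq_integral_abs; [exact: measurable_ditv| |exact: int0].
  by apply/measurable_EFinP; exact: measurable_funS mv.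
(* Each point of the interval lies in one of two null sets: where [w] is nonzero, or where [w] is
   not positive. *)
have : mu.-negligible (ditv R I).
  apply: negligibleS (negligibleU w0 wpos) => x Ix.
  have [wx|wx] := pselect (0 < w x); [left|by right].
  by move=> /(_ Ix) [wx0]; rewrite wx0 ltxx in wx.
move=> [N [mN N0 IN]].
have := lebesgue_measure_ditv_gt0 R I.
rewrite ltNge => /negP; apply.
rewrite -N0; apply: le_measure; rewrite ?inE//; exact: measurable_ditv.
Qed.

(** Squaring removes the outer root, a finite partial sum is at most the series, and each kept term
    integrates to its coefficient times the mass of [v]. *)
Lemma sum_le_integral_square_fun v w f (s : seq dyadic) : weight v -> uniq s ->
  ((\sum_(I <- s) `|wavg w I f - wavg w (parent I) f| ^+ 2 * mass v I)%:E <=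
   \int[mu]_x (`|square_fun w f x| ^+ 2 * (v x)%:E))%E.
Proof.
move=> wv us; have mv := weight_measurable wv.
pose c I := `|wavg w I f - wavg w (parent I) f| ^+ 2.
have c0 I : 0 <= c I by exact: exprn_ge0.
pose S x := (\esum_(I in [set: dyadic]) (c I * \1_(ditv R I) x)%:E)%E.
have S0 x : (0 <= S x)%E by apply: esum_ge0 => I _; rewrite lee_fin mulr_ge0.
have SE x : (`|square_fun w f x| ^+ 2 = S x)%E.
  by rewrite /square_fun -/(S x) gee0_abs ?poweR_ge0// poweR12_sqrt// sqr_sqrte.
have mS : measurable_fun [set: R] S.
  apply: (@measurable_esum _ _ _ (int * int)%type) => I.
    by move=> x; rewrite lee_fin mulr_ge0.
  apply/measurable_EFinP; apply: measurable_funM => //.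
  by apply: measurable_indic; exact: measurable_ditv.
pose nv x := `|v x|.
have mnv : measurable_fun [set: R] nv by exact: measurableT_comp.
(* [v] is only almost everywhere positive, so it is first replaced by [`|v|]. *)
rewrite (_ : (\int[mu]_x _)%E = \int[mu]_x (S x * (nv x)%:E))%E; last first.
  under eq_integral do rewrite SE.
  apply: ae_eq_integral => //.
  - by apply: emeasurable_funM => //; exact/measurable_EFinP.
  - by apply: emeasurable_funM => //; exact/measurable_EFinP.
  - move: (weight_ae_norm wv).
    by apply: (@filterS _ _ (ae_filter_ringOfSetsType mu)) => x + _ => ->.
have mnvI I : measurable_fun [set: R] (nv \_ (ditv R I)).
  apply/(measurable_restrictT _ _).1; first exact: measurable_ditv.
  exact: measurable_funS mnv.
have nvI0 I x : 0 <= (nv \_ (ditv R I)) x.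
  by rewrite patchE; case: ifP => // _; exact: normr_ge0.
have mg I : measurable_fun [set: R] (fun x => c I * (nv \_ (ditv R I)) x).
  exact: measurable_funM.
have g0 I x : 0 <= c I * (nv \_ (ditv R I)) x by exact: mulr_ge0.
rewrite (_ : (_)%:E =
    \int[mu]_x (\sum_(I <- s) (c I * (nv \_ (ditv R I)) x)%:E))%E; last first.
  rewrite ge0_integral_sum//; last 2 first.
    by move=> I; apply/measurable_EFinP; exact: mg.
    by move=> I x _; rewrite lee_fin; exact: g0.
  rewrite -sumEFin; apply: eq_bigr => I _.
  under eq_integral do rewrite EFinM.
  rewrite ge0_integralZl_EFin//; last 2 first.
  - by move=> x _; rewrite lee_fin; exact: nvI0.
  - by apply/measurable_EFinP; exact: mnvI.
  rewrite EFinM weight_normE//; congr (_ * _)%E; rewrite [LHS]integral_mkcond.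
  by apply: eq_integral => x _; rewrite !patchE; case: ifP.
apply: ge0_le_integral => //.
- by move=> x _; apply: sume_ge0 => I _; rewrite lee_fin; exact: g0.
- by apply: emeasurable_sum => I; apply/measurable_EFinP; exact: mg.
- by apply: emeasurable_funM => //; exact/measurable_EFinP.
move=> x _.
rewrite (_ : (\sum_(I <- s) _)%E =
    (\sum_(I <- s) (c I * \1_(ditv R I) x)%:E) * (nv x)%:E)%E; last first.
  rewrite !sumEFin -EFinM mulr_suml; congr EFin; apply: eq_bigr => I _.
  by rewrite patch_indic /= mulrA mulrAC.
apply: lee_wpmul2r; first by rewrite lee_fin normr_ge0.
(* The unordered sum is a supremum over finite sets; as [s] has no repetitions, its set of entries
   gives the same sum. *)
apply: esum_ge; exists [set` s]; first by split => //; exact: finite_seq.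
by rewrite -fsbig_seq.
Qed.

End mass.

(** * The test function and the inequality it yields *)

Section testing.
Variable R : realType.
Local Notation mu := (@lebesgue_measure R).
Implicit Types (u v w f g : R -> R) (I J : dyadic).

(** On [J], where [u] is nonzero, both [f * w] and [f ^+ 2 * u] equal [u^-1 * w ^+ 2], so one mass
    governs the averages and the norm of [f]. *)
Definition test_fun u w J : R -> R := (fun x => (u x)^-1 * w x) \_ (ditv R J).

(** Regarding [u^-1 * w ^+ 2] as a weight makes its masses positive, hence available as divisors. *)
Lemma dual_weight u w : weight u -> weight w ->
  locally_integrable [set: R] (fun x => (u x)^-1 * w x ^+ 2) ->
  weight (fun x => (u x)^-1 * w x ^+ 2).
Proof.
move=> [_ u0] [_ w0] h; split => //; move: u0 w0.
apply: (@filterS2 _ _ (ae_filter_ringOfSetsType mu)) => x u0 w0.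
by rewrite mulr_gt0 ?invr_gt0 ?exprn_gt0.
Qed.

Lemma wavg_density u w I :
  wavg w I (fun x => (u x)^-1 * w x) =
  (mass w I)^-1 * mass (fun x => (u x)^-1 * w x ^+ 2) I.
Proof.
by congr (_ * _); apply: eq_Rintegral => x _; rewrite -mulrA -expr2.
Qed.

(** The factor [w] cancels only where it is nonzero, so the two integrands agree merely almost
    everywhere. *)
Lemma wavg_inv v w I : weight v -> weight w ->
  wavg w I (fun x => v x * (w x)^-1) = (mass w I)^-1 * mass v I.
Proof.
move=> wv ww; have [mv mw] := (weight_measurable wv, weight_measurable ww).
have mwV : measurable_fun [set: R] (fun x => (w x)^-1).
  by apply: measurableT_comp mw; exact: measurable_inv.
congr (_ * fine _); apply: ae_eq_integral.
- exact: measurable_ditv.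
- apply/measurable_EFinP.
  apply: (@measurable_funS _ _ _ _ setT) => //.
  by do 2 apply: measurable_funM => //.
- by apply/measurable_EFinP; exact: measurable_funS mv.
- case: ww => _; apply: (@filterS _ _ (ae_filter_ringOfSetsType mu)) => x w0 _.
  by rewrite divfK// gt_eqF.
Qed.

Lemma wavg_restrict w g I J :
  wavg w I (g \_ (ditv R J)) =
  (mass w I)^-1 * \int[mu]_(x in ditv R I `&` ditv R J) (g x * w x).
Proof.
rewrite /wavg Rintegral_mkcondr; congr (_ * _); apply: eq_Rintegral => x _.
by rewrite !patchE; case: ifP => // _; rewrite mul0r.
Qed.

Lemma wavg_restrict_sub w g I J : ditv R I `<=` ditv R J ->
  wavg w I (g \_ (ditv R J)) = wavg w I g.
Proof. by move=> IJ; rewrite wavg_restrict (setIidl IJ). Qed.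

Lemma wavg_restrict_sup w g I J : ditv R J `<=` ditv R I ->
  wavg w I (g \_ (ditv R J)) =
  (mass w I)^-1 * \int[mu]_(x in ditv R J) (g x * w x).
Proof. by move=> JI; rewrite wavg_restrict (setIidr JI). Qed.

Lemma measurable_test_fun u w J :
  measurable_fun [set: R] u -> measurable_fun [set: R] w ->
  measurable_fun [set: R] (test_fun u w J).
Proof.
move=> mu' mw; apply/(measurable_restrictT _ _).1; first exact: measurable_ditv.
apply: (@measurable_funS _ _ _ _ setT) => //; apply: measurable_funM => //.
by apply: measurableT_comp mu'; exact: measurable_inv.
Qed.

Lemma integral_sqr_test_fun u w J : weight u -> weight w ->
  locally_integrable [set: R] (fun x => (u x)^-1 * w x ^+ 2) ->
  (\int[mu]_x (`|(test_fun u w J x)%:E| ^+ 2 * (u x)%:E) =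
   (mass (fun x => (u x)^-1 * w x ^+ 2)%R J)%:E)%E.
Proof.
move=> wu ww h; rewrite EFin_mass// [RHS]integral_mkcond.
have [mu' mw] := (weight_measurable wu, weight_measurable ww).
have mf := measurable_test_fun J mu' mw.
have mh : measurable_fun [set: R] (fun x => (u x)^-1 * w x ^+ 2) by case: h.
apply: ae_eq_integral => //.
- apply: emeasurable_funM; last exact/measurable_EFinP.
  under eq_fun do rewrite -EFin_expe.
  by apply/measurable_EFinP; apply: measurable_funX; exact: measurableT_comp.
- apply/(measurable_restrictT _ _).1; first exact: measurable_ditv.
  by apply/measurable_EFinP; exact: measurable_funS mh.
case: wu => _; apply: (@filterS _ _ (ae_filter_ringOfSetsType mu)) => x u0 _.
rewrite /test_fun !patchE; case: ifP => _; last by rewrite abse0 expe2 !mul0e.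
rewrite -EFin_expe -EFinM real_normK ?num_real//; congr EFin.
by field; rewrite gt_eqF.
Qed.

Lemma square_fun_testing u v w : weight u -> weight v -> weight w ->
    locally_integrable [set: R] (fun x => (u x)^-1 * w x ^+ 2) ->
    bounded_L2 (square_fun w) u v ->
  exists C : R, 0 < C /\ forall J (s : seq dyadic), uniq s ->
    \sum_(I <- s) `|wavg w I (test_fun u w J) -
                     wavg w (parent I) (test_fun u w J)| ^+ 2 * mass v I <=
    C * mass (fun x => (u x)^-1 * w x ^+ 2) J.
Proof.
(* The norm inequality gets squared, and its constant with it. *)
move=> wu wv ww h [C [C0 SC]]; exists (C ^+ 2); split; first exact: exprn_gt0.
move=> J s us; set f := test_fun u w J.
have A0 := mass_gt0 J (dual_weight wu ww h).
set A := mass _ J in A0 *.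
have fA : wL2norm u (EFin \o f) = (Num.sqrt A)%:E.
  by rewrite /wL2norm integral_sqr_test_fun// poweR12_sqrt ?lee_fin ?ltW.
have mf : measurable_fun [set: R] f.
  by apply: measurable_test_fun; exact: weight_measurable.
have := SC f; rewrite /wL2 fA ltry => /(_ (conj mf isT)).
rewrite /wL2norm; set X := (\int[_]_x _)%E => XA.
have sX : (_ <= X)%E := sum_le_integral_square_fun w f wv us.
(* The integrand may be negative on a null set; the partial-sum bound for the empty list gives the
   sign of [X] instead. *)
have X0 : (0 <= X)%E.
  by have := sum_le_integral_square_fun w f wv (isT : uniq [::]); rewrite big_nil.
rewrite -lee_fin; apply: (le_trans sX).
move: XA; rewrite poweR12_sqrt// => XA.
rewrite -(sqr_sqrte X0) expe2.
have -> : (C ^+ 2 * A)%:E = (C%:E * (Num.sqrt A)%:E * (C%:E * (Num.sqrt A)%:E))%E.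
  by rewrite -!EFinM mulrACA -!expr2 sqr_sqrtr// ltW.
by apply: lee_pmul => //; exact: sqrte_ge0.
Qed.

End testing.

(** * The two necessary conditions, with the testing constant serving both *)

Theorem theorem2 (R : realType) (u v w : R -> R)
    (hu : weight u) (hv : weight v) (hw : weight w)
    (huw : locally_integrable [set: R] (fun x => (u x)^-1 * w x ^+ 2))
    (hvloc : locally_integrable [set: R] v)
    (hS : bounded_L2 (square_fun w) u v) :
  (exists C : R, 0 < C /\
     forall J : dyadic,
       (mass w (sibling J) / mass w (parent J)) ^+ 2
         * wavg w J (fun x => (u x)^-1 * w x)
         * wavg w J (fun x => v x * (w x)^-1) <= C)
  /\
  (exists C : R, 0 < C /\
     forall J : dyadic,
       (((mass w J)^-1)%:E *
         (\esum_(I in [set I : dyadic | ditv R I `<=` ditv R J])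
            (`|wdelta w I (fun x => ((u x)^-1 * w x)%R)| ^+ 2 *
              ((mass w (lchild I) ^+ 2 * mass v (rchild I)
                + mass w (rchild I) ^+ 2 * mass v (lchild I))
               / mass w I ^+ 2))%:E)
       <= (C * wavg w J (fun x => ((u x)^-1 * w x)%R))%:E)%E).
Proof.
have [C [C0 SC]] := square_fun_testing hu hv hw huw hS.
have lw : locally_integrable [set: R] w by case: hw.
have A0 I := mass_gt0 I (dual_weight hu hw huw).
have w0 I := mass_gt0 I hw.
split; exists C; split=> // J.
  have := SC J [:: J] isT; rewrite big_seq1/= wavg_restrict_sub//.
  rewrite wavg_restrict_sup; last exact: ditv_parent_subset.
  rewrite wavg_inv// wavg_density.
  have -> : \int[lebesgue_measure]_(x in ditv R J) ((u x)^-1 * w x * w x) =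
      mass (fun x => (u x)^-1 * w x ^+ 2) J.
    by apply: eq_Rintegral => x _; rewrite -mulrA -expr2.
  rewrite mass_sibling// real_normK ?num_real// => le_CA.
  (* Multiplying by the mass [A] of [u^-1 * w ^+ 2] on [J] gives an equality with the tested term,
     since [A / w(J) - A / w(parent J) = A w(sibling J) / (w(J) w(parent J))]. *)
  rewrite -(ler_pM2r (A0 J)); apply: le_trans le_CA; rewrite le_eqVlt; apply/orP; left.
  by apply/eqP; field; rewrite !gt_eqF ?addr_gt0//.
set h := (fun x => (u x)^-1 * w x ^+ 2) in A0 SC *.
rewrite wavg_density mulrCA EFinM; apply: lee_wpmul2l.
  by rewrite lee_fin invr_ge0 ltW.
(* The series is a supremum of finite partial sums, so it suffices to bound each of them by the same
   constant. *)
apply: ge_ereal_sup => _ [X [finX XJ] <-].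
rewrite fsbig_finite//= sumEFin lee_fin.
set s := finmap.enum_fset _.
have sJ I : I \in s -> ditv R I `<=` ditv R J.
  by rewrite in_fset_set// inE => /XJ.
(* Each child map is injective because [parent] undoes it; right children have odd indices and left
   children even ones, so the two halves of the list share no entry. *)
have us : uniq (map (@rchild) s ++ map (@lchild) s).
  rewrite cat_uniq !map_inj_uniq; [|exact: can_inj lchildK|exact: can_inj rchildK].
  rewrite finmap.fset_uniq andbT/=; apply/hasPn => _ /mapP[I _ ->].
  apply/mapP => -[K _ [_ /eqP]].
  lia.
apply: le_trans (SC J _ us); rewrite big_cat !big_map /= -big_split /=.
rewrite le_eqVlt; apply/orP; left; apply/eqP.
apply: eq_big_seq => I /sJ IJ.
rewrite lchildK rchildK !wavg_restrict_sub//; last 2 first.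
  by move=> x /ditv_lchild_subset /IJ.
  by move=> x /ditv_rchild_subset /IJ.
rewrite /wdelta !wavg_density -/h.
(* Splitting both masses over the children exhibits the average over [I] as the combination of the
   children's averages with weights [w(I^-) / w(I)] and [w(I^+) / w(I)]; the rest is algebra. *)
rewrite !real_normK ?num_real// (mass_children I lw) (mass_children I huw) -/h.
by field; rewrite !gt_eqF ?addr_gt0.
Qed.
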